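(* Let $\delta>0$, and let $G_X$ be the generator of a continuous-time Markov chain on $\delta\mathbb{Z}$, $$G_Xf(\delta k)=\sum_{\ell\in\mathbb{Z}}\beta_\ell(\delta k)\big(f(\delta(k+\ell))-f(\delta k)\big),\qquad k\in\mathbb{Z},$$ where $\beta_\ell(\delta k)$ is the transition rate from $\delta k$ to $\delta(k+\ell)$. Fix $f:\delta\mathbb{Z}\to\mathbb{R}$ and assume that $G_Xf(\delta k)$ is defined on all of $\delta\mathbb{Z}$. Assume also that $$\sum_{\ell\in\mathbb{Z}}\big|\beta_\ell(\delta k)\big(f(\delta(k+\ell))-f(\delta k)\big)\big|<\infty,\qquad k\in\mathbb{Z},$$ which is trivially satisfied when the number of transitions from each state is finite. Then, with $A$ the interpolation operator and $\alpha^k_{k+i}$ its weights (see context) and $k(x)=\lfloor x/\delta\rfloor$, $$AG_Xf(x)=\sum_{\ell\in\mathbb{Z}}A\beta_\ell(x)\big(Af(x+\delta\ell)-Af(x)\big)+\varepsilon(x),\qquad x\in\mathbb{R}.$$ The error $\varepsilon(x)$ satisfies $$\varepsilon(x)=\sum_{\ell\in\mathbb{Z}}\sum_{i=0}^4\alpha^{k(x)}_{k(x)+i}(x)\Big(\beta_\ell\big(\delta(k(x)+i)\big)-A\beta_\ell(x)\Big)\Big(1(\ell>0)\sum_{j=0}^{i-1}\sum_{m=0}^{\ell-1}\Delta^2f\big(\delta(k(x)+m+j)\big)-1(\ell<0)\sum_{j=0}^{i-1}\sum_{m=\ell}^{-1}\Delta^2f\big(\delta(k(x)+m+j)\big)\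Big).$$
   Context: $\Delta f(\delta k)=f(\delta(k+1))-f(\delta k)$ and $\Delta^{j+1}f(\delta k)=\Delta^jf(\delta(k+1))-\Delta^jf(\delta k)$; $1(\cdot)$ is the indicator, and empty sums are zero. Interpolation operator. For $g:\delta\mathbb{Z}\to\mathbb{R}$ and $t=(x-\delta k)/\delta$, put $$P_k(x)=g(\delta k)+t\big(\Delta-\tfrac12\Delta^2+\tfrac13\Delta^3\big)g(\delta k)+\tfrac12t^2\big(\Delta^2-\Delta^3\big)g(\delta k)+\tfrac16t^3\Delta^3g(\delta k)+\big(-\tfrac{23}{3}t^4+\tfrac{41}{2}t^5-\tfrac{55}{3}t^6+\tfrac{11}{2}t^7\big)\Delta^4g(\delta k).$$ Expanding the differences, $P_k(x)=\sum_{i=0}^4\alpha^k_{k+i}(x)g(\delta(k+i))$, where the weight $\alpha^k_{k+i}(x)$ is the coefficient of $g(\delta(k+i))$ (a polynomial in $t$ not depending on $g$). Then $Ag(x)=P_{k(x)}(x)=\sum_{i=0}^4\alpha^{k(x)}_{k(x)+i}(x)g(\delta(k(x)+i))$ for $x\in\mathbb{R}$. $A\beta_\ell$ denotes $A$ applied to the function $\delta k\mapsto\beta_\ell(\delta k)$ and $AG_Xf$ denotes $A$ applied to $\delta k\mapsto G_Xf(\delta k)$.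
   Formalization: The series of Aβ_ℓ(x)(Af(x+δℓ)−Af(x)) and the series for ε(x) may each diverge under the stated assumptions; the identity is proved for the termwise combined series always, and in the displayed separated form whenever one (equivalently both) of the two series converges. *)

(* Defs.v *)
From HB Require Import structures.
From mathcomp Require Import all_boot all_order all_algebra.
From mathcomp Require Import all_classical all_reals all_analysis.
From mathcomp Require Import ring.
Set Implicit Arguments.
Unset Strict Implicit.
Unset Printing Implicit Defensive.
Import Order.TTheory GRing.Theory Num.Theory.
Import numFieldNormedType.Exports.
Local Open Scope classical_set_scope.
Local Open Scope ring_scope.

(* For delta > 0, a function g on the grid delta Z is encoded as
   g : int -> R, where g k stands for g(delta k). *)

Definition fdiff (R : realType) (g : int -> R) (k : int) : R :=
  g (k + 1) - g k.

Definition interp_poly (R : realType) (delta : R) (g : int -> R) (k : int)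
    (x : R) : R :=
  let t := (x - delta * k%:~R) / delta in
  let D n := iter n (@fdiff R) g k in
  g k
  + t * (D 1%N - 1 / 2 * D 2%N + 1 / 3 * D 3%N)
  + 1 / 2 * t ^+ 2 * (D 2%N - D 3%N)
  + 1 / 6 * t ^+ 3 * D 3%N
  + (- (23 / 3) * t ^+ 4 + 41 / 2 * t ^+ 5 - 55 / 3 * t ^+ 6
     + 11 / 2 * t ^+ 7) * D 4%N.

(* The coefficient alpha^k_m(x) of g(delta m) in P_k(x).  Since P_k(x) is
   linear in g, it is the value of P_k(x) at the indicator function of
   delta m; see interp_polyE below. *)
Definition weight (R : realType) (delta : R) (k m : int) (x : R) : R :=
  interp_poly delta (fun n => (n == m)%:R) k x.

Lemma interp_polyE (R : realType) (delta : R) (g : int -> R) (k : int)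
    (x : R) :
  interp_poly delta g k x =
  \sum_(i < 5) weight delta k (k + i%:Z) x * g (k + i%:Z).
Proof.
have E (a b : int) : (k + a == k + b) = (a == b) by rewrite (inj_eq (addrI k)).
have E0 (b : int) : (k == k + b) = (0 == b) by rewrite -{1}(addr0 k) E.
rewrite /weight /interp_poly !big_ord_recl big_ord0 /= /fdiff -!addrA.
rewrite !E !E0 /= addr0.
set t := _ / delta; clearbody t.
set g1 := g (k + 1); set g2 := g (k + 2); set g3 := g (k + 3).
set g4 := g (k + 4).
by field.
Qed.

Definition grid_floor (R : realType) (delta x : R) : int :=
  Num.floor (x / delta).

Definition interp (R : realType) (delta : R) (g : int -> R) (x : R) : R :=
  interp_poly delta g (grid_floor delta x) x.

(* A series over Z converges when its halves over l >= 0 and over l < 0 both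
   do; Negz n is - (n + 1). *)
Definition zcvg (R : realType) (u : int -> R) : Prop :=
  cvgn (series (fun n => u (Posz n))) /\ cvgn (series (fun n => u (Negz n))).

Definition zsum (R : realType) (u : int -> R) : R :=
  limn (series (fun n => u (Posz n))) + limn (series (fun n => u (Negz n))).

Definition zabs_cvg (R : realType) (u : int -> R) : Prop :=
  summable [set: int] (fun l => (u l)%:E).

Definition sumz (R : realType) (a b : int) (F : int -> R) : R :=
  if a <= b then \sum_(n < `|b - a|%N.+1) F (a + n%:Z) else 0.

(* beta l k is the rate beta_l(delta k) of the jump delta k -> delta (k + l).
   The value at l = 0 is unconstrained: it does not affect the generator. *)
Definition transition_rates (R : realType) (beta : int -> int -> R) : Prop :=
  (forall l k, l != 0 -> 0 <= beta l k) /\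
  (forall k, summable [set l : int | l != 0] (fun l => (beta l k)%:E)).

Definition generator_term (R : realType) (beta : int -> int -> R)
    (f : int -> R) (k l : int) : R :=
  beta l k * (f (k + l) - f k).

Definition generator (R : realType) (beta : int -> int -> R) (f : int -> R)
    (k : int) : R :=
  zsum (generator_term beta f k).

Definition main_term (R : realType) (delta : R) (beta : int -> int -> R)
    (f : int -> R) (x : R) (l : int) : R :=
  interp delta (beta l) x *
  (interp delta f (x + delta * l%:~R) - interp delta f x).

Definition error_term (R : realType) (delta : R) (beta : int -> int -> R)
    (f : int -> R) (x : R) (l : int) : R :=
  let k := grid_floor delta x in
  let D2f := iter 2 (@fdiff R) f in
  \sum_(i < 5)
    weight delta k (k + i%:Z) x
    * (beta l (k + i%:Z) - interp delta (beta l) x)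
    * ((0 < l)%R%:R
         * (\sum_(j < i) sumz 0 (l - 1) (fun m => D2f (k + m + j%:Z)))
       - (l < 0)%R%:R
         * (\sum_(j < i) sumz l (-1) (fun m => D2f (k + m + j%:Z)))).

Definition error (R : realType) (delta : R) (beta : int -> int -> R)
    (f : int -> R) (x : R) : R :=
  zsum (error_term delta beta f x).

(* Main.v *)
Require Import Defs.
From HB Require Import structures.
From mathcomp Require Import all_boot all_order all_algebra.
From mathcomp Require Import all_classical all_reals all_analysis.
From mathcomp Require Import ring.
Set Implicit Arguments.
Unset Strict Implicit.
Unset Printing Implicit Defensive.
Import Order.TTheory GRing.Theory Num.Theory.
Import numFieldNormedType.Exports.
Local Open Scope classical_set_scope.
Local Open Scope ring_scope.

(** Put k = floor (x / delta), let w_i be the weight of the node k + i in the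
interpolation at x, let B = A beta_l (x), and let
d_i = f (k + i + l) - f (k + i) be the increment of f over a jump by l from
that node.  Everything reduces to one finite identity for each fixed l: the
main term plus the error term is sum_i w_i beta_l (k + i) d_i, the l-th term of
A G_X f (x) ([main_error_termE]).

- Interpolation commutes with grid translations ([interp_shift]), so the main
  term is B * sum_i w_i d_i.
- The double sums of second differences telescope, first in m and then in j,
  and the bracket in the error term is d_i - d_0 for either sign of l
  ([error_bracket]).
- The interpolation reproduces constants, so sum_i w_i = 1 and
  sum_i w_i (beta_l (k + i) - B) = 0.  Hence the d_0 in the bracket has no
  effect, and the error term is the weighted covariance of the rates and the
  increments: exactly the gap between the weighted mean of the products
  beta_l (k + i) * d_i and the product of the weighted means
  ([weighted_covariance]).

Summing over l is then linear: A G_X f (x) combines five series, and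
convergence, absolute convergence and sums of series over the integers are
compatible with finite linear combinations ([zcvg_comb], [zabs_cvg_comb]).
Since main plus error converges, one of the two series converges if and only
if the other does. *)

Section IndexedSeries.
Variable R : realType.
Implicit Types u v : int -> R.

Lemma zabs_cvg0 : zabs_cvg (fun=> 0 : R).
Proof. by rewrite /zabs_cvg /summable esum1// => l _ /=; rewrite normr0. Qed.

Lemma zabs_cvgD u v :
  zabs_cvg u -> zabs_cvg v -> zabs_cvg (fun l => u l + v l).
Proof. by move=> uc vc; exact: (summableD uc vc). Qed.

(** Scaling is checked on the finite partial sums, of which the unordered sum of
the absolute values is the supremum. *)
Lemma zabs_cvgZ (c : R) u : zabs_cvg u -> zabs_cvg (fun l => c * u l).
Proof.
rewrite /zabs_cvg => u_cvg.
have/(le_lt_trans _): (`|c|%:E * (\esum_(l in [set: int]) `|(u l)%:E|) < +oo)%E.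
  by rewrite lte_mul_pinfty// lee_fin.
apply.
apply: ge_ereal_sup => _ [X [finX XT]] <-.
have -> : (\sum_(l \in X) `|(c * u l)%:E| =
           `|c|%:E * \sum_(l \in X) `|(u l)%:E|)%E.
  rewrite ge0_mule_fsumr//; apply: eq_fsbigr => l _.
  by rewrite EFinM abseM.
by rewrite lee_wpmul2l ?lee_fin//; apply: ereal_sup_ubound; exists X.
Qed.

Lemma zabs_cvg_finite u : finite_set [set l | u l != 0] -> zabs_cvg u.
Proof.
move=> finu; rewrite /zabs_cvg /summable.
have -> : (\esum_(l in [set: int]) `|(u l)%:E| =
           \esum_(l in [set l | u l != 0%R]) `|(u l)%:E|)%E.
  rewrite [RHS]esum_mkcond; apply: eq_esum => l _.
  case: ifPn => //; rewrite notin_setE /= => /negP.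
  by rewrite negbK => /eqP ->; rewrite /= normr0.
rewrite esum_fset// fsbig_finite//= sumEFin.
exact: ltry.
Qed.

Lemma zcvg0 : zcvg (fun=> 0 : R) /\ zsum (fun=> 0 : R) = 0.
Proof.
have -> : zsum (fun=> 0 : R) = 0 + 0.
  rewrite /zsum (_ : series _ = fun=> 0) ?lim_cst//.
  by apply/funext => n; rewrite /series /= big1.
rewrite addr0; split=> //.
rewrite /zcvg (_ : series _ = fun=> 0); last first.
  by apply/funext => n; rewrite /series /= big1.
by split; exact: is_cvg_cst.
Qed.

Lemma zcvgD u v : zcvg u -> zcvg v -> zcvg (fun l => u l + v l).
Proof. by move=> [up un] [vp vn]; split; apply: is_cvg_seriesD. Qed.

Lemma zsumD u v :
  zcvg u -> zcvg v -> zsum (fun l => u l + v l) = zsum u + zsum v.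
Proof.
move=> [up un] [vp vn]; rewrite /zsum.
rewrite (lim_seriesD up vp) (lim_seriesD un vn).
by rewrite addrACA.
Qed.

Lemma zcvgZ (c : R) u : zcvg u -> zcvg (fun l => c * u l).
Proof.
by move=> [up un]; split; apply: is_cvg_seriesZ.
Qed.

Lemma zsumZ (c : R) u : zcvg u -> zsum (fun l => c * u l) = c * zsum u.
Proof.
move=> [up un]; rewrite /zsum mulrDr.
by rewrite (lim_seriesZ c up) (lim_seriesZ c un).
Qed.

(** Each of u and v is the convergent sum minus the other. *)
Lemma zcvg_addr u v : zcvg (fun l => u l + v l) -> zcvg u <-> zcvg v.
Proof.
move=> uv; split=> [uc|vc].
  have -> : v = fun l => (u l + v l) + -1 * u l.
    by apply/funext => l; ring.
  exact/zcvgD/zcvgZ.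
have -> : u = fun l => (u l + v l) + -1 * v l by apply/funext => l; ring.
exact/zcvgD/zcvgZ.
Qed.

Section Combination.
Variables (n : nat) (c : 'I_n -> R) (u : 'I_n -> int -> R).

Lemma zabs_cvg_comb :
  (forall i, zabs_cvg (u i)) -> zabs_cvg (fun l => \sum_i c i * u i l).
Proof.
move=> u_cvg; rewrite (_ : (fun l => _) = \sum_i (fun l => c i * u i l)).
  elim/big_ind: _ => [|v w|i _]; first exact: zabs_cvg0.
  - exact: zabs_cvgD.
  - exact: zabs_cvgZ.
by apply/funext => l; rewrite fct_sumE.
Qed.

Lemma zcvg_comb : (forall i, zcvg (u i)) ->
  zcvg (fun l => \sum_i c i * u i l) /\
  zsum (fun l => \sum_i c i * u i l) = \sum_i c i * zsum (u i).
Proof.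
move=> u_cvg; rewrite (_ : (fun l => _) = \sum_i (fun l => c i * u i l)).
  elim/big_rec2: _ => [|i s v _ [v_cvg <-]]; first exact: zcvg0.
  have cu := zcvgZ (c i) (u_cvg i).
  by split; [exact: zcvgD|rewrite (zsumD cu v_cvg) zsumZ].
by apply/funext => l; rewrite fct_sumE.
Qed.

End Combination.
End IndexedSeries.

Section Interpolation.
Variables (R : realType) (delta : R).
Implicit Types (g : int -> R) (k l : int) (x : R).

(** The interpolation of the constant function 1 is 1, because its differences
vanish. *)
Lemma sum_weight k x : \sum_(i < 5) weight delta k (k + i%:Z) x = 1.
Proof.
have := interp_polyE delta (fun=> 1) k x.
under eq_bigr do rewrite mulr1.
move=> <-; rewrite /interp_poly /= /fdiff; ring.
Qed.

Lemma interp_sumE g x (k := grid_floor delta x) :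
  interp delta g x = \sum_(i < 5) weight delta k (k + i%:Z) x * g (k + i%:Z).
Proof. exact: interp_polyE. Qed.

Lemma grid_floor_shift x l : 0 < delta ->
  grid_floor delta (x + delta * l%:~R) = grid_floor delta x + l.
Proof.
move=> d0; rewrite /grid_floor mulrDl mulrAC divff ?gt_eqF// mul1r.
by rewrite floorDrz ?intrKfloor ?intr_int.
Qed.

(** Translating x by delta * l moves the base node by l and leaves the local
coordinate t = (x - delta * k) / delta unchanged. *)
Lemma interp_shift g x l : 0 < delta ->
  interp delta g (x + delta * l%:~R) = interp delta (fun k => g (k + l)) x.
Proof.
move=> d0; rewrite /interp grid_floor_shift//.
set k := grid_floor delta x.
rewrite /interp_poly /= /fdiff.
have -> : x + delta * l%:~R - delta * (k + l)%:~R = x - delta * k%:~R.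
  by rewrite intrD; ring.
by rewrite !(addrAC _ l).
Qed.

(** The bound a <= b + 1 admits the empty range b = a - 1, where both sides are
0; for b < a - 1 the empty sum would no longer be the difference of the
endpoint values. *)
Lemma sumz_telescope (F : int -> R) (a b : int) : a <= b + 1 ->
  sumz a b (fun m => F (m + 1) - F m) = F (b + 1) - F a.
Proof.
move=> ab; rewrite /sumz; case: ifPn => [le_ab|]; last first.
  rewrite -ltNge -lezD1 => ba.
  by rewrite (_ : b + 1 = a) ?subrr//; apply/eqP; rewrite eq_le ba ab.
transitivity (\sum_(0 <= n < `|b - a|%N.+1) (F (a + n.+1%:Z) - F (a + n%:Z))).
  rewrite big_mkord; apply: eq_bigr => n _.
  by rewrite intS (addrC 1) addrA.
rewrite (telescope_sumr (fun n : nat => F (a + n%:Z)))//= addr0; congr (F _ - _).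
rewrite intS gez0_abs ?subr_ge0//; ring.
Qed.

(** A sum of second differences over a rectangle is the mixed difference of f at
its corners: telescoping in m leaves first differences, which telescope
in j. *)
Lemma sumz_fdiff2 (f : int -> R) (k a b : int) (i : nat) : a <= b + 1 ->
  \sum_(j < i) sumz a b (fun m => iter 2 (@fdiff R) f (k + m + j%:Z)) =
  f (k + (b + 1) + i%:Z) - f (k + (b + 1)) - (f (k + a + i%:Z) - f (k + a)).
Proof.
move=> ab.
have tel c : \sum_(j < i) fdiff f (c + j%:Z) = f (c + i%:Z) - f c.
  transitivity (\sum_(0 <= j < i) (f (c + j.+1%:Z) - f (c + j%:Z))).
    rewrite big_mkord; apply: eq_bigr => j _.
    by rewrite /fdiff -addrA (addrC j%:Z) -intS.
  by rewrite (telescope_sumr (fun j : nat => f (c + j%:Z)))//= addr0.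
rewrite -!tel -sumrB; apply: eq_bigr => j _.
rewrite -(sumz_telescope (fun m => fdiff f (k + m + j%:Z)) ab).
congr (sumz _ _ _); apply/funext => m /=.
by rewrite -[LHS]/(fdiff f _ - fdiff f _) (addrA k m 1) (addrAC _ 1).
Qed.

(** The two indicator sums give the same closed form: for l > 0 the range
0..l-1 telescopes to the values at l and 0, and for l < 0 the range l..-1
telescopes to the values at 0 and l, which the minus sign reverses. *)
Lemma error_bracket (f : int -> R) k l (i : nat) :
  let D2f := iter 2 (@fdiff R) f in
  (0 < l)%R%:R * (\sum_(j < i) sumz 0 (l - 1) (fun m => D2f (k + m + j%:Z)))
  - (l < 0)%R%:R * (\sum_(j < i) sumz l (-1) (fun m => D2f (k + m + j%:Z)))
  = f (k + i%:Z + l) - f (k + i%:Z) - (f (k + l) - f k).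
Proof.
cbv zeta.
case: (ltrgtP 0 l) => [l0|l0|<-].
- by rewrite mul1r mul0r subr0 sumz_fdiff2 ?subrK ?ltW// addr0 (addrAC k); ring.
- by rewrite mul1r mul0r sub0r sumz_fdiff2 ?addNr ?ltW// addr0 (addrAC k); ring.
- by rewrite !mul0r !addr0 !subrr.
Qed.

End Interpolation.

(** The identity E[bd] = E[b] E[d] + Cov(b, d) for signed weights of total mass
1.  The increment d may be recentred at any constant c, since b - B has
weighted mean 0. *)
Lemma weighted_covariance (R : comPzRingType) (n : nat) (w b d : 'I_n -> R)
    (B c : R) :
  \sum_i w i = 1 -> B = \sum_i w i * b i ->
  B * (\sum_i w i * d i) + \sum_i w i * (b i - B) * (d i - c) =
  \sum_i w i * (b i * d i).
Proof.
move=> w1 BE.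
have -> : \sum_i w i * (b i - B) * (d i - c) =
    \sum_i w i * (b i * d i) - B * (\sum_i w i * d i)
    - c * (\sum_i w i * b i - B * \sum_i w i).
  rewrite !mulr_sumr -!sumrB mulr_sumr -sumrB.
  by apply: eq_bigr => i _; ring.
by rewrite w1 -BE; ring.
Qed.

(** The pointwise identity behind the decomposition: [weighted_covariance] with
b the rates and d the increments of f at the five nodes, and c the increment at
the base node. *)
Lemma main_error_termE (R : realType) (delta : R) (beta : int -> int -> R)
    (f : int -> R) (x : R) (l : int) (k := grid_floor delta x) : 0 < delta ->
  main_term delta beta f x l + error_term delta beta f x l =
  \sum_(i < 5)
    weight delta k (k + i%:Z) x * generator_term beta f (k + i%:Z) l.
Proof.
move=> d0; rewrite /generator_term.
rewrite -(weighted_covariance _ (f (k + l) - f k) (sum_weight delta k x)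
            (interp_sumE delta (beta l) x)).
rewrite /main_term interp_shift// !interp_sumE -sumrB; congr (_ * _ + _).
  by apply: eq_bigr => i _; rewrite mulrBr.
rewrite /error_term -/k; apply: eq_bigr => i _.
by rewrite error_bracket interp_sumE.
Qed.

(* The hypotheses make the combined series absolutely convergent, but not each
   of the two series separately; these converge or diverge together, and when
   they converge the identity reads A G_X f = (main series) + error. *)
Theorem proposition1 (R : realType) (delta : R) (hdelta : 0 < delta)
    (beta : int -> int -> R) (hbeta : transition_rates beta) (f : int -> R) :
  ((forall k, finite_set [set l : int | l != 0 /\ beta l k != 0]) ->
     forall k, zabs_cvg (generator_term beta f k)) /\
  ((forall k, zcvg (generator_term beta f k)) ->
   (forall k, zabs_cvg (generator_term beta f k)) ->
   forall x : R,
     let a := main_term delta beta f x in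
     let e := error_term delta beta f x in
     [/\ zabs_cvg (fun l => a l + e l),
         interp delta (generator beta f) x = zsum (fun l => a l + e l),
         zcvg a <-> zcvg e &
         zcvg a ->
         interp delta (generator beta f) x = zsum a + error delta beta f x]).
Proof.
split=> [finbeta k|gcvg gabs x a e].
  apply: zabs_cvg_finite; apply: sub_finite_set (finbeta k) => l /=.
  rewrite /generator_term; have [->|l0] := eqVneq l 0.
    by rewrite addr0 subrr mulr0 eqxx.
  by move=> bf0; split=> //; apply: contraNneq bf0 => ->; rewrite mul0r.
set k := grid_floor delta x.
have aeE : (fun l => a l + e l) = fun l => \sum_(i < 5)
    weight delta k (k + i%:Z) x * generator_term beta f (k + i%:Z) l.
  by apply/funext => l; exact: main_error_termE.
have [ae_cvg ae_sum] := zcvg_comb (fun i : 'I_5 => weight delta k (k + i%:Z) x)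
  (fun i => gcvg (k + i%:Z)).
rewrite -aeE in ae_cvg ae_sum.
have AGE : interp delta (generator beta f) x = zsum (fun l => a l + e l).
  by rewrite ae_sum interp_sumE.
have ae_iff := zcvg_addr ae_cvg.
split=> //; first by rewrite aeE; exact: zabs_cvg_comb.
by move=> ac; rewrite AGE zsumD//; exact/ae_iff.
Qed.
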